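(* Let $\lambda>0$. Let $(X,d_X)$ be an extended metric space, and let $E:X\to(-\infty,\infty]$ be bounded from below with nonempty domain $D(E)=\{E<\infty\}$. Let $Y\subset X$, equipped with the induced length metric $d_Y$. Suppose that for each $y\in Y\cap D(E)$ there exists an $\mathrm{EVI}_\lambda$-flow $(\gamma^y_t)_{t>0}$ of $E$ in $(X,d_X)$ which starts from $y$, such that $\gamma^y_t\in Y$ for each $t>0$. Suppose also that $Y$ is a geodesic space and that $\inf_{y\in Y}E(y)$ is attained at some $y_*\in Y$. Then $$d_Y^2(y,y_* )\le\frac2\lambda\big(E(y)-E(y_* )\big),\qquad\forall y\in Y.$$
   Context: The inequality is regarded as trivially true when $E(y)=\infty$. Extended metric space: $d_X$ satisfies all axioms of a metric except that it may take the value $+\infty$. Absolutely continuous curves: for a bounded interval $I\subset\mathbb{R}$ and $p\in[1,\infty]$, $AC^p(I;(X,d_X))$ is the set of maps $\gamma:I\to X$ for which there is $m\in L^p(I)$ with $d_X(\gamma_s,\gamma_t)\le\int_s^t m(u)\,du$ for all $s<t$ in $I$; $AC:=AC^1$. The metric derivative is $|\dot\gamma|_t=\limsup_{s\to t}d_X(\gamma_s,\gamma_t)/|s-t|$. $AC^2_{\rm loc}((0,\infty);(X,d_X))$ consists of maps $\gamma:(0,\infty)\to X$ whose restriction to each bounded interval $I\subset(0,\infty)$ is in $AC^2(I;(X,d_X))$. $\mathrm{EVI}_\lambda$-flow: $\gamma\in AC^2_{\rm loc}((0,\infty);(X,d_X))$ is an $\mathrm{EVI}_\lambda$-flow of $E$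 in $(X,d_X)$ if $t\mapsto E(\gamma_t)$ is lower semicontinuous and finite-valued, and for all $x\in D(E)$ with $d_X(x,\{\gamma_t:t>0\})<\infty$, $$\frac12\frac{d^+}{dt}d_X^2(\gamma_t,x)+\frac\lambda2 d_X^2(\gamma_t,x)\le E(x)-E(\gamma_t),\qquad\forall t>0,$$ where $d^+/dt$ is the upper right derivative. It starts at (from) $x\in D(E)$ if $d_X(\gamma_t,x)\to0$ as $t\downarrow0$ and $\liminf_{t\downarrow0}E(\gamma_t)\ge E(x)$. Induced length metric on $Y\subset X$: $d_Y(y,y')=\inf\int_0^1|\dot\gamma|_t\,dt$ over $\gamma\in AC([0,1];(X,d_X))$ with $\gamma_t\in Y$ for all $t$, $\gamma_0=y$, $\gamma_1=y'$ (with $|\dot\gamma|$ computed in $d_X$, and $\inf\emptyset=+\infty$). $Y$ is a geodesic space if for every $y,y'\in Y$ there is $\gamma:[0,1]\to Y$ with $\gamma_0=y$, $\gamma_1=y'$ and $d_Y(\gamma_s,\gamma_t)=|t-s|\,d_Y(y,y')<\infty$ for all $s,t\in[0,1]$. *)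

(* Defs.v *)
From HB Require Import structures.
From mathcomp Require Import all_boot all_order all_algebra.
From mathcomp Require Import all_classical all_reals all_analysis.

Set Implicit Arguments.
Unset Strict Implicit.
Unset Printing Implicit Defensive.

Import Order.TTheory GRing.Theory Num.Theory.
Import numFieldNormedType.Exports.

Local Open Scope classical_set_scope.
Local Open Scope ring_scope.
Local Open Scope ereal_scope.

Section extended_metric.
Context {R : realType} {X : Type}.

Record extended_metric (d : X -> X -> \bar R) : Prop := ExtendedMetric {
  emetric_ge0 : forall x y, 0 <= d x y ;
  emetric_eq0 : forall x y, d x y = 0 <-> x = y ;
  emetric_sym : forall x y, d x y = d y x ;
  emetric_triangle : forall x y z, d x z <= d x y + d y z }.

Definition effective_domain (E : X -> \bar R) : set X := [set x | E x < +oo].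

End extended_metric.

(* A curve defined on a subset [I] of the line is a total function [R -> X];
   every notion below only depends on its values on [I]. *)
Section curves.
Context {R : realType} {X : Type}.
Variable d : X -> X -> \bar R.

(* [p] is meant to range over [1, +oo] and [I] over the bounded intervals. *)
Definition AC_curve (p : \bar R) (I : set R) (g : R -> X) : Prop :=
  exists2 m : R -> R, (m \_ I)%R \in Lfun lebesgue_measure p &
    forall s t, I s -> I t -> (s < t)%R ->
      d (g s) (g t) <= \int[lebesgue_measure]_(u in `[s, t]) (m u)%:E.

Definition AC2loc (g : R -> X) : Prop :=
  forall I : set R, is_interval I -> bounded_set I -> I `<=` `]0%R, +oo[ ->
    AC_curve 2%:E I g.

Definition metric_derivative (I : set R) (g : R -> X) (t : R) : \bar R :=
  limf_esup (fun s => d (g s) (g t) / (`|s - t|%R)%:E) (within I t^').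

Definition curve_length (g : R -> X) : \bar R :=
  \int[lebesgue_measure]_(t in `[0%R, 1%R]) metric_derivative `[0%R, 1%R] g t.

Definition length_dist (Y : set X) (y y' : X) : \bar R :=
  ereal_inf [set curve_length g | g in
    [set g : R -> X | [/\ AC_curve 1 `[0%R, 1%R] g,
                          forall t : R, (0 <= t <= 1)%R -> Y (g t),
                          g 0%R = y & g 1%R = y']]].

Definition geodesic_space (Y : set X) : Prop :=
  forall y y', Y y -> Y y' ->
    exists g : R -> X,
      [/\ forall t : R, (0 <= t <= 1)%R -> Y (g t), g 0%R = y, g 1%R = y' &
          forall s t : R, (0 <= s <= 1)%R -> (0 <= t <= 1)%R ->
            length_dist Y (g s) (g t) = (`|t - s|%R)%:E * length_dist Y y y'
            /\ length_dist Y y y' < +oo].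

End curves.

Section evi.
Context {R : realType} {X : Type}.
Variables (d : X -> X -> \bar R) (E : X -> \bar R).

Definition upper_right_derivative (f : R -> \bar R) (t : R) : \bar R :=
  limf_esup (fun s => (f s - f t) / (s - t)%:E) t^'+.

Definition dist_to_set (x : X) (A : set X) : \bar R :=
  ereal_inf [set d x a | a in A].

(* In the inequality all distances are finite: [x] is at finite distance from
   some point of the curve, hence from all of them since the curve is AC. *)
Definition EVI_flow (lambda : R) (g : R -> X) : Prop :=
  [/\ AC2loc d g,
      lower_semicontinuous (fun t : subspace (`]0%R, +oo[%classic : set R) => E (g t)),
      forall t : R, (0 < t)%R -> E (g t) \is a fin_num &
      forall x, effective_domain E x -> dist_to_set x [set g t | t in `]0%R, +oo[] < +oo ->
        forall t : R, (0 < t)%R ->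
          (2^-1)%:E * upper_right_derivative (fun s => d (g s) x ^+ 2) t
            + (lambda / 2)%:E * d (g t) x ^+ 2 <= E x - E (g t)].

Definition starts_from (g : R -> X) (x : X) : Prop :=
  (d (g t) x @[t --> (0 : R)^'+] --> 0) /\
  E x <= limf_einf (fun t => E (g t)) (0 : R)^'+.

End evi.

(* Main.v *)
Require Import Defs.
From mathcomp Require Import all_boot all_order all_algebra.
From mathcomp Require Import all_classical all_reals all_analysis.
From mathcomp Require Import measurable_realfun lra ring.

Import Order.TTheory GRing.Theory Num.Theory.
Import numFieldNormedType.Exports.

Local Open Scope classical_set_scope.
Local Open Scope ring_scope.

(* This is the Otto-Villani argument.  Let [y_t] be the flow from [y] and
   [phi(t) = sqrt (2 / lambda * (E y_t - E ystar))].  The EVI with base points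
   on the flow says that the energy dissipates at least at the squared speed;
   the EVI with base point [ystar] says that
   [2 * lambda * (E y_t - E ystar)] is at most the squared speed.  Together
   they give [d(y_s, y_t) <= phi(s) - phi(t)].  Since moreover [phi(t)] and
   [d(y_t, ystar)] tend to [0], reparametrizing the flow by the level of [phi]
   yields a curve in [Y] from [y] to [ystar] that is Lipschitz with constant
   [phi(0)], so [d_Y(y, ystar) <= phi(0)].  All differential inequalities are integrated by
   Dini's monotonicity criterion, without almost everywhere derivatives. *)

(** * Integration of differential inequalities by Dini's criterion *)

(** Lower semicontinuity from the left only: the criterion below approaches a supremum from
    below. *)
Definition left_lsc {R : realType} (F : R -> R) (c : R) :=
  forall e, 0 < e ->
    exists2 r0, 0 <= r0 < c & forall r, r0 < r < c -> F c <= F r + e.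

(** For a fixed slope [e > 0], the times [t] with [F t <= F a + e * (t - a)] contain their supremum
    by left semicontinuity, and the Dini condition would push past a supremum smaller than [b]. Then
    [e] tends to zero. *)
Lemma dini_nonincreasing {R : realType} (F : R -> R) (a b : R) :
    0 < a -> a <= b ->
    (forall c, a < c <= b -> left_lsc F c) ->
    (forall e, 0 < e -> forall s, a <= s < b ->
       exists2 t, s < t <= b & F t <= F s + e * (t - s)) ->
  F b <= F a.
Proof.
move=> a0 ab Flsc Fdini.
suff H e : 0 < e -> F b <= F a + e * (b - a).
  apply/ler_addgt0Pr => e e0.
  have h : 0 < e / (b - a + 1) by apply: divr_gt0 => //; lra.
  apply: le_trans (H _ h) _; rewrite lerD2l -mulrAC ler_pdivrMr; [nra|lra].
move=> e0.
pose S := [set t | a <= t <= b /\ F t <= F a + e * (t - a)].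
have Sa : S a by split; [rewrite lexx | rewrite subrr mulr0 addr0].
have Sub : has_ubound S by exists b => t [/andP[]].
have Ssup : has_sup S by split => //; exists a.
set c := sup S.
have ac : a <= c by exact: ub_le_sup.
have cb : c <= b by apply: ge_sup => [|t [/andP[]]//]; exists a.
have Sc : S c.
  split; first by rewrite ac.
  have [<-|ac'] := eqVneq a c; first by case: Sa.
  have {}ac' : a < c by rewrite lt_neqAle ac' ac.
  apply/ler_addgt0Pr => e' e'0.
  have acb : a < c <= b by rewrite ac' cb.
  have [r0 /andP[_ r0c] Hr0] := Flsc _ acb _ e'0.
  have [r Sr r0r] := sup_adherent (eps := c - r0) ltac:(by rewrite subr_gt0) Ssup.
  rewrite -/c opprB addrC subrK in r0r.
  have rc : r <= c by exact: ub_le_sup.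
  case: Sr => /andP[ar rb] Hr.
  have [rc'|rc'] := eqVneq r c; first by rewrite -rc'; lra.
  have {}rc' : r < c by rewrite lt_neqAle rc' rc.
  have := Hr0 r; rewrite r0r rc' => /(_ isT) ?; nra.
have [cb'|cb'] := eqVneq c b; first by rewrite -cb'; case: Sc.
have {}cb' : a <= c < b by rewrite ac lt_neqAle cb' cb.
have [t /andP[ct tb] Ht] := Fdini e e0 c cb'.
have : S t.
  split; first by rewrite tb andbT; lra.
  by case: Sc => _ ?; nra.
by move=> /(ub_le_sup Sub); rewrite -/c; lra.
Qed.

(* [u] plays the role of the squared distance to a point [x] along the flow,
   [f] that of the energy along the flow, and [Ex] that of [E x]. *)
Definition evi_along {R : realType} (lambda : R) (u f : R -> R) (Ex : R) :=
  forall t e, 0 < t -> 0 < e -> exists2 dl, 0 < dl &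
    forall s, t < s < t + dl ->
      u s - u t <= (s - t) * (2 * (Ex - f t) - lambda * u t + e).

(** Dini's criterion for [u - P], where [P] is the primitive of [N + 2 * M * (s - a)], the assumed
    bound on the slope of [u]. *)
Lemma evi_along_quadratic_bound {R : realType} (lambda Ex N M a b : R)
    (u f : R -> R) :
    evi_along lambda u f Ex ->
    0 < a -> a <= b -> 0 <= M ->
    (forall c, a < c <= b -> left_lsc u c) ->
    (forall s, a <= s < b ->
       2 * (Ex - f s) - lambda * u s <= N + 2 * M * (s - a)) ->
  u b <= u a + N * (b - a) + M * (b - a) ^+ 2.
Proof.
move=> evi a0 ab M0 ulsc H.
pose P t := N * (t - a) + M * (t - a) ^+ 2.
suff: u b - P b <= u a - P a by rewrite /P subrr; lra.
apply: (@dini_nonincreasing _ (fun t => u t - P t)) => //.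
  move=> c acb e e0.
  have e20 : 0 < e / 2 by lra.
  have [r0 /andP[r00 r0c] Hr0] := ulsc c acb (e / 2) e20.
  have : 0 < `|N| + 1 + 2 * M * (c - a).
    by have := normr_ge0 N; case/andP: acb => ? ?; nra.
  set k := _ + _ => k0.
  (* [k] bounds the slope of [P] on [[a, c]], so [P] varies by at most [e / 2] over the last
     [e / 2 / k] units of time. *)
  exists (Num.max (Num.max a r0) (c - e / 2 / k)).
    rewrite !le_max !gt_max r00 orbT r0c /=; case/andP: acb => -> _ /=.
    by rewrite ltrBlDr ltrDl divr_gt0.
  move=> r; rewrite !gt_max => /andP[/andP[/andP[ar r0r] rk] rc].
  have := Hr0 r; rewrite r0r rc => /(_ isT) hu.
  have : P r - P c <= e / 2.
    have -> : P r - P c = (c - r) * (- N - M * (c + r - 2 * a)).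
      by rewrite /P; ring.
    have : (c - r) * k <= e / 2 by rewrite -ler_pdivlMr//; lra.
    apply: le_trans; apply: ler_wpM2l; first lra.
    have := ler_norm (- N); rewrite normrN /k => hN.
    have : 0 <= M * (c + r - 2 * a) by apply: mulr_ge0; lra.
    have : 0 <= 2 * M * (c - a) by apply: mulr_ge0; lra.
    lra.
  by lra.
move=> e e0 s /andP[as_ sb].
have [|dl dl0 Hdl] := evi s e _ e0; first lra.
pose t := Num.min b (s + dl / 2).
have st : s < t by rewrite lt_min sb; lra.
have tb : t <= b by rewrite ge_min lexx.
have tdl : t < s + dl by rewrite /t gt_min; apply/orP; right; lra.
exists t; first by rewrite st.
have := Hdl t; rewrite st tdl => /(_ isT) h.
have hs : a <= s < b by rewrite as_.
have h2 : (s < t) && (t < s + dl) by rewrite st.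
have {h}: u t - u s <= (t - s) * (N + 2 * M * (s - a) + e).
  apply: le_trans h _; apply: ler_wpM2l; first lra.
  by have := H s hs; lra.
(* As [P] is convex, its increment is at least that of its tangent at [s]. *)
have : P t - P s = (t - s) * (N + M * (t + s - 2 * a)) by rewrite /P; ring.
have : 0 <= (t - s) * (M * (t - s)) by apply: mulr_ge0; [lra|nra].
by nra.
Qed.

(** * Left continuity along a flow *)

Section metric_flow.
Context {R : realType} (w : R -> R -> R).

(** [w s t] stands for the distance between the points of the flow at times [s] and [t]. *)
Definition left_continuous_flow := forall t e, 0 < t -> 0 < e ->
  exists2 r0, 0 <= r0 < t & forall r, r0 < r < t -> w r t <= e.

Hypothesis w_left : left_continuous_flow.

Lemma left_lsc_of_dist (v : R -> R) (t : R) :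
    0 < t -> (forall r, 0 < r < t -> v t <= v r + w r t) -> left_lsc v t.
Proof.
move=> t0 H e e0; have [r0 r0t Hr0] := w_left t e t0 e0.
exists r0 => // r r0r; have := Hr0 r r0r.
by have := H r ltac:(lra); lra.
Qed.

Lemma left_lsc_sqr (v : R -> R) (t : R) :
    0 < t -> (forall r, 0 < r -> 0 <= v r) ->
    (forall r, 0 < r < t -> v t <= v r + w r t) ->
  left_lsc (fun r => v r ^+ 2) t.
Proof.
move=> t0 v0 H e e0.
have vt := v0 t t0.
(* If [v r < v t], the squares differ by at most [(v t - v r) * (2 * v t)]; the [+ 1] keeps the
   denominator positive. *)
have h0 : 0 < e / (2 * v t + 1) by apply: divr_gt0; lra.
have [r0 r0t Hr0] := w_left t _ t0 h0.
exists r0 => // r r0r; have hw := Hr0 r r0r.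
have vr := v0 r ltac:(lra).
have hv := H r ltac:(lra).
have [vtr|vrt] := leP (v t) (v r); first nra.
have : (v t - v r) * (2 * v t + 1) <= e by rewrite -ler_pdivlMr; lra.
nra.
Qed.

End metric_flow.

(** * Energy and distance estimates along an EVI flow, in real variables *)

Section evi_flow.
Context {R : realType}.
(** [f] is the energy along the flow, [D] the distance to the minimiser and [f_inf] the minimal
    energy. *)
Variables (lambda : R) (w : R -> R -> R) (f D : R -> R) (f_inf : R).
Hypothesis lambda_gt0 : 0 < lambda.
Hypothesis w_ge0 : forall s t, 0 < s -> 0 < t -> 0 <= w s t.
Hypothesis w_xx : forall s, 0 < s -> w s s = 0.
Hypothesis w_tri : forall r s t, 0 < r -> 0 < s -> 0 < t ->
  w r t <= w r s + w s t.
Hypothesis w_left : left_continuous_flow w.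
Hypothesis f_lsc : forall t a, 0 < t -> a < f t ->
  exists2 dl, 0 < dl & forall r, 0 < r -> `|r - t| < dl -> a < f r.
Hypothesis f_ge : forall t, 0 < t -> f_inf <= f t.
Hypothesis f_const : forall s t, 0 < s -> 0 < t -> w s t = 0 -> f s = f t.
Hypothesis evi_w : forall s, 0 < s ->
  evi_along lambda (fun t => w s t ^+ 2) f (f s).
Hypothesis D_ge0 : forall t, 0 < t -> 0 <= D t.
Hypothesis D_tri : forall s t, 0 < s -> 0 < t -> D s <= D t + w s t.
Hypothesis D_tri' : forall s t, 0 < s -> 0 < t -> D t <= D s + w s t.
Hypothesis evi_D : evi_along lambda (fun t => D t ^+ 2) f f_inf.

Let w2_lsc s t : 0 < s -> 0 < t -> left_lsc (fun t => w s t ^+ 2) t.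
Proof.
move=> s0 t0; apply: (left_lsc_sqr w) => // [r r0|r /andP[r0 _]].
  exact: w_ge0.
exact: w_tri.
Qed.

Let D2_lsc t : 0 < t -> left_lsc (fun t => D t ^+ 2) t.
Proof.
by move=> t0; apply: (left_lsc_sqr w) => // r /andP[r0 _]; exact: D_tri'.
Qed.

(** With the flow at time [s] as base point, the initial distance vanishes and the [lambda] term has
    a favourable sign. *)
Let w2_bound s t N M : 0 < s -> s <= t -> 0 <= M ->
  (forall r, s <= r < t -> 2 * (f s - f r) <= N + 2 * M * (r - s)) ->
  w s t ^+ 2 <= N * (t - s) + M * (t - s) ^+ 2.
Proof.
move=> s0 st M0 H.
have := @evi_along_quadratic_bound _ lambda (f s) N M s t _ _ (evi_w s s0) s0 st M0.
rewrite w_xx// expr0n add0r; apply.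
  by move=> c cs; apply: w2_lsc; lra.
move=> r sr; apply: le_trans (H r sr).
by rewrite gerBl mulr_ge0 ?sqr_ge0// ltW.
Qed.

(** [T] collects the [t] such that energies arbitrarily near the infimum [i] still occur on
    [[t, b]]. If [f] exceeded [i] at [s = sup T], it would stay away from [i] near [s] by
    semicontinuity, and [T] would extend beyond [s]. *)
Lemma energy_min_on_segment a b : 0 < a -> a <= b ->
  exists2 s, a <= s <= b & forall t, a <= t <= b -> f s <= f t.
Proof.
move=> a0 ab.
pose V := [set f t | t in [set t | a <= t <= b]].
have Vinf : has_inf V.
  split; first by exists (f a); exists a => //=; rewrite lexx.
  by exists f_inf => _ [t /= /andP[at_ _] <-]; apply: f_ge; lra.
pose i := inf V.
have iV t : a <= t <= b -> i <= f t.
  by move=> tab; apply: ge_inf; [case: Vinf | exists t].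
pose T := [set t | a <= t <= b /\
  forall e, 0 < e -> exists2 r, t <= r <= b & f r < i + e].
have Ta : T a.
  split=> [|e e0]; first by rewrite lexx.
  by have [_ [r rab <-] ri] := inf_adherent e0 Vinf; exists r.
have Tub : has_ubound T by exists b => t [/andP[]].
have Tsup : has_sup T by split => //; exists a.
set s := sup T.
have as_ : a <= s by exact: ub_le_sup.
have sb : s <= b by apply: ge_sup => [|t [/andP[]]//]; exists a.
exists s; first by rewrite as_.
suff fs : f s <= i by move=> t /iV; exact: le_trans.
rewrite leNgt; apply/negP => fs.
have [dl dl0 Hdl] := f_lsc s ((f s + i) / 2) ltac:(lra) ltac:(lra).
have [t Tt] := sup_adherent dl0 Tsup; rewrite -/s => st.
have ts : t <= s by exact: ub_le_sup.
have Hfar e : 0 < e -> exists2 r, s + dl <= r <= b & f r < i + e.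
  move=> e0; case: Tt => /andP[at_ tb] Tt.
  (* The cap [(f s - i) / 2] puts [f r] below the level exceeded by [f] near [s], so [r] lies beyond
     that neighbourhood. *)
  have [r /andP[tr rb] fr] := Tt (Num.min e ((f s - i) / 2)) ltac:(rewrite lt_min; lra).
  have fre : f r < i + e by apply: lt_le_trans fr _; rewrite lerD2l ge_min lexx.
  have frh : f r < i + (f s - i) / 2.
    by apply: lt_le_trans fr _; rewrite lerD2l ge_min lexx orbT.
  exists r => //; rewrite rb andbT leNgt; apply/negP => rs.
  have := Hdl r ltac:(lra); rewrite ltr_norml => /(_ ltac:(apply/andP; split; lra)).
  lra.
have : T (s + dl).
  have [r rab _] := Hfar 1 ltac:(lra).
  by split => //; lra.
by move=> /(ub_le_sup Tub); rewrite -/s; lra.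
Qed.

(* From a minimiser [s] of the energy on [[a, b]] the flow does not move: by
   the EVI with base point [y_s], the distance to [y_s] cannot increase. *)
Lemma energy_nonincreasing a b : 0 < a -> a <= b -> f b <= f a.
Proof.
move=> a0 ab; have [s sab smin] := energy_min_on_segment a b a0 ab.
have s0 : 0 < s by lra.
have sb : s <= b by lra.
have := w2_bound s b 0 0 s0 sb (lexx _).
rewrite !mul0r addr0 => H.
have {}H : w s b ^+ 2 <= 0.
  apply: H => r srb; have := smin r ltac:(lra); lra.
have : w s b = 0 by apply/eqP; rewrite -sqrf_eq0 eq_le H sqr_ge0.
move=> /(f_const s b s0 ltac:(lra)) <-; apply: smin; lra.
Qed.

Lemma dist_sqr_le_energy s t : 0 < s -> s <= t ->
  w s t ^+ 2 <= 2 * (f s - f t) * (t - s).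
Proof.
move=> s0 st; have := w2_bound s t (2 * (f s - f t)) 0 s0 st (lexx _).
rewrite mul0r addr0; apply => r srt.
have := energy_nonincreasing r t ltac:(lra) ltac:(lra); lra.
Qed.

(** Integrating the linear bound [2 * M * (r - s)] avoids the factor 2 that [dist_sqr_le_energy]
    loses by bounding every drop by the final one. The sharp constant is essential in
    [local_dist_le_height]. *)
Lemma dist_sqr_le_slope s t M : 0 < s -> s <= t -> 0 <= M ->
  (forall r, s < r < t -> f s - f r <= M * (r - s)) ->
  w s t ^+ 2 <= M * (t - s) ^+ 2.
Proof.
move=> s0 st M0 H.
have := w2_bound s t 0 M s0 st M0; rewrite mul0r add0r; apply => r srt.
have [->|rs] := eqVneq r s; first by rewrite !subrr; lra.
have := H r; have -> : s < r < t by rewrite lt_neqAle eq_sym rs.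
move=> /(_ isT); lra.
Qed.

(** Both [f] and [D] are nonincreasing, so on [[s, t]] the EVI with the minimiser as base point can
    be bounded by their values at [t]. *)
Lemma minimizer_dist_decrease s t : 0 < s -> s <= t ->
  2 * (t - s) * (f t - f_inf + lambda / 2 * D t ^+ 2) <= D s ^+ 2 - D t ^+ 2.
Proof.
move=> s0 st.
have Dmono r r' : 0 < r -> r <= r' -> D r' ^+ 2 <= D r ^+ 2.
  move=> r0 rr'.
  have := @evi_along_quadratic_bound _ lambda f_inf 0 0 r r' _ _ evi_D r0 rr' (lexx _).
  rewrite !mul0r !addr0; apply => [c cr|q rq]; first by apply: D2_lsc; lra.
  have := f_ge q ltac:(lra).
  have : 0 <= lambda * D q ^+ 2 by rewrite mulr_ge0 ?sqr_ge0// ltW.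
  lra.
have := @evi_along_quadratic_bound _ lambda f_inf
  (- (2 * (f t - f_inf + lambda / 2 * D t ^+ 2))) 0 s t _ _ evi_D s0 st (lexx _).
rewrite mul0r addr0 => H.
suff: D t ^+ 2 <= D s ^+ 2 + - (2 * (f t - f_inf + lambda / 2 * D t ^+ 2)) * (t - s).
  by move=> ?; nra.
apply: H => [c cr|q sq]; first by apply: D2_lsc; lra.
have q0 : 0 < q by lra.
have qt : q <= t by lra.
have := energy_nonincreasing q t q0 qt.
have := Dmono q t q0 qt; rewrite -(ler_pM2l lambda_gt0); lra.
Qed.

(** The triangle inequality bounds [D s] by [D t + w s t] in [minimizer_dist_decrease]; completing
    the square in [lambda * h * y - v] then eliminates [y = D t]. *)
Lemma energy_le_speed s t : 0 < s -> s <= t ->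
  2 * lambda * (f t - f_inf) * (t - s) ^+ 2 <= w s t ^+ 2 * (1 + lambda * (t - s)).
Proof.
move=> s0 st; have t0 : 0 < t by lra.
have := minimizer_dist_decrease s t s0 st.
have := D_tri s t s0 t0; have := D_ge0 s s0; have := D_ge0 t t0.
have := w_ge0 s t s0 t0.
move: (D s) (D t) (w s t) (f t - f_inf) => x y v e v0 y0 x0 xy H.
have Hx : x ^+ 2 <= (y + v) ^+ 2 by nra.
have h0 : 0 <= t - s by lra.
move: (t - s) h0 H => h h0 H.
have {H}: 2 * h * e <= 2 * v * y - lambda * h * y ^+ 2 + v ^+ 2 by nra.
move=> /(ler_wpM2l (mulr_ge0 (ltW lambda_gt0) h0)) H.
have := sqr_ge0 (lambda * h * y - v); nra.
Qed.

(** Time [1] is an arbitrary positive reference. This bound and the next each keep one of the two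
    nonnegative terms of [minimizer_dist_decrease]. *)
Lemma minimizer_dist_decay t : 1 <= t -> lambda * (t - 1) * D t ^+ 2 <= D 1 ^+ 2.
Proof.
move=> t1; have := minimizer_dist_decrease 1 t ltr01 t1.
have := f_ge t ltac:(lra); have := sqr_ge0 (D t).
set e := f t; set q := D t ^+ 2 => q0 e0.
have : 0 <= (t - 1) * (e - f_inf) by rewrite mulr_ge0; lra.
nra.
Qed.

Lemma energy_decay t : 1 <= t -> 2 * (t - 1) * (f t - f_inf) <= D 1 ^+ 2.
Proof.
move=> t1; have := minimizer_dist_decrease 1 t ltr01 t1.
have := sqr_ge0 (D t).
set e := f t; set q := D t ^+ 2 => q0.
have lq : 0 <= lambda * q by rewrite mulr_ge0// ltW.
have : 0 <= (t - 1) * (lambda * q) by rewrite mulr_ge0// subr_ge0.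
nra.
Qed.

(** * Distance controlled by the height, and reparametrization by its level *)

Definition energy_height (t : R) := Num.sqrt (2 / lambda * (f t - f_inf)).

Let phi := energy_height.

Let phi_ge0 t : 0 <= phi t. Proof. exact: sqrtr_ge0. Qed.

Let phi2 t : 0 < t -> lambda / 2 * phi t ^+ 2 = f t - f_inf.
Proof.
move=> t0; have lam0 := lambda_gt0.
rewrite sqr_sqrtr; first by field; lra.
by rewrite mulr_ge0 ?divr_ge0 ?subr_ge0 ?f_ge //; lra.
Qed.

Lemma energy_height_nonincreasing s t : 0 < s -> s <= t ->
  energy_height t <= energy_height s.
Proof.
move=> s0 st; apply: ler_wsqrtr; apply: ler_wpM2l.
  by rewrite divr_ge0// ltW.
have := energy_nonincreasing s t s0 st; lra.
Qed.

(* If the speed exceeded the rate of decrease of the height by [eps] on the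
   whole of [[s, s + dl]], then [C := sup d(y_s, y_t) / (t - s)] would satisfy
   [C ^ 2 <= K (C - eps)] by the EVI with base point [y_s], and [K <= C] by
   [energy_le_speed], where [K = lambda phi(s)]. *)
Lemma local_dist_le_height s b e : 0 < s -> s < b -> 0 < e ->
  exists2 t, s < t <= b &
    w s t <= energy_height s - energy_height t + e * (t - s).
Proof.
move=> s0 sb e0; have lam0 := lambda_gt0; apply: contrapT => Hn.
have {}Hn t : s < t <= b -> phi s - phi t + e * (t - s) < w s t.
  by move=> stb; rewrite ltNge; apply/negP => ?; apply: Hn; exists t.
pose K := lambda * phi s.
have K0 : 0 <= K by rewrite mulr_ge0// ltW.
(* With heights [x >= y] at [s] and [t], the drop is [lambda / 2 * (x - y) * (x + y)], at most
   [K * (x - y)]. *)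
have drop t : s < t <= b -> f s - f t <= K * (w s t - e * (t - s)).
  move=> stb; have t0 : 0 < t by lra.
  have -> : f s - f t = lambda / 2 * phi s ^+ 2 - lambda / 2 * phi t ^+ 2.
    by rewrite !phi2//; ring.
  have hst := energy_height_nonincreasing s t s0 ltac:(lra).
  have := Hn t stb; have := phi_ge0 t; rewrite /K -/phi in hst *.
  move: (phi s) (phi t) hst => x y yx y0 h.
  have hx : 0 <= x by lra.
  have : (x - y) * (x + y) <= (x - y) * (2 * x) by apply: ler_wpM2l; lra.
  have : (x - y) * x <= (w s t - e * (t - s)) * x by apply: ler_wpM2r; lra.
  nra.
have w_gt t : s < t <= b -> e * (t - s) < w s t.
  move=> stb; have := Hn t stb.
  have := energy_height_nonincreasing s t s0 ltac:(lra); rewrite -/phi; lra.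
pose Q := [set w s t / (t - s) | t in [set t | s < t <= b]].
have Qub : has_ubound Q.
  (* The bound of [dist_sqr_le_energy], combined with [drop], gives [w ^ 2 <= 2 * K * w * (t - s)]:
     enough for [C] to be finite. *)
  exists (2 * K) => _ [t /= stb <-].
  have ts : 0 < t - s by lra.
  rewrite ler_pdivrMr//.
  have := dist_sqr_le_energy s t s0 ltac:(lra).
  have := drop t stb; have := w_gt t stb.
  move: (t - s) (w s t) (f s - f t) ts => h v p h0 hv hp hvv.
  have v0 : 0 < v by nra.
  rewrite -(ler_pM2l v0).
  have : p * h <= K * v * h by apply: ler_wpM2r; nra.
  nra.
have Qne : Q !=set0 by exists (w s b / (b - s)); exists b => //=; rewrite sb lexx.
set C := sup Q.
have wC t : s < t <= b -> w s t <= C * (t - s).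
  move=> stb; rewrite -ler_pdivrMr; last lra.
  by apply: ub_le_sup => //; exists t.
have eC : e < C.
  have := wC b; have := w_gt b; rewrite sb lexx => /(_ isT) + /(_ isT) => h1 h2.
  have : e * (b - s) < C * (b - s) by lra.
  by rewrite ltr_pM2r; lra.
have CK : C ^+ 2 <= K * (C - e).
  have B0 : 0 <= K * (C - e) by rewrite mulr_ge0; lra.
  rewrite -(sqr_sqrtr B0) ler_sqr ?nnegrE ?sqrtr_ge0//; last lra.
  apply: ge_sup => // _ [t /= stb <-].
  rewrite ler_pdivrMr; last lra.
  rewrite -ler_sqr ?nnegrE; last 2 first.
  - by apply: w_ge0; lra.
  - by rewrite mulr_ge0 ?sqrtr_ge0//; lra.
  rewrite exprMn sqr_sqrtr//; apply: dist_sqr_le_slope => //; first lra.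
  move=> r srt; have srb : s < r <= b by lra.
  apply: le_trans (drop r srb) _; rewrite -[leRHS]mulrA; apply: ler_wpM2l => //.
  by have := wC r srb; lra.
have KC : K ^+ 2 <= C ^+ 2.
  have -> : K ^+ 2 = 2 * lambda * (f s - f_inf) by rewrite -phi2// /K; field.
  rewrite leNgt; apply/negP => hlt.
  (* [a] is the midpoint between [C ^ 2 / (2 * lambda)] and the excess energy at [s]; semicontinuity
     keeps the excess above [a] near [s]. *)
  pose a := (C ^+ 2 / (2 * lambda) + (f s - f_inf)) / 2.
  have hC : C ^+ 2 / (2 * lambda) < f s - f_inf by rewrite ltr_pdivrMr; lra.
  have hC' : C ^+ 2 = 2 * lambda * (C ^+ 2 / (2 * lambda)) by field; lra.
  have [dl dl0 Hdl] := f_lsc s (f_inf + a) s0 ltac:(rewrite /a; lra).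
  have C2 : 0 < C ^+ 2 by rewrite exprn_gt0; lra.
  pose g := 2 * lambda * a - C ^+ 2.
  have g0 : 0 < g.
    have : 2 * lambda * (C ^+ 2 / (2 * lambda)) < 2 * lambda * a.
      by rewrite ltr_pM2l; [rewrite /a; lra | rewrite mulr_gt0].
    rewrite /g; lra.
  (* The last cap lets the gap [g] absorb the error factor [1 + lambda * h] of [energy_le_speed]. *)
  pose h := Num.min (Num.min (dl / 2) (b - s)) (g / (C ^+ 2 * lambda)).
  have h0 : 0 < h.
    rewrite !lt_min; apply/andP; split; last by rewrite divr_gt0// mulr_gt0.
    by apply/andP; split; lra.
  have hdl : h <= dl / 2 by rewrite /h !ge_min lexx.
  have hb : h <= b - s by rewrite /h !ge_min lexx orbT.
  have hg : C ^+ 2 * lambda * h <= g.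
    rewrite mulrC -ler_pdivlMr; first by rewrite /h !ge_min lexx orbT.
    by rewrite mulr_gt0.
  have fa : f_inf + a < f (s + h).
    by apply: Hdl; [lra | rewrite addrAC subrr add0r gtr0_norm; lra].
  have := energy_le_speed s (s + h) s0 ltac:(lra).
  have := wC (s + h) ltac:(lra).
  have := w_ge0 s (s + h) s0 ltac:(lra).
  rewrite addrAC subrr add0r; move: (w s (s + h)) => v v0 vC.
  have : v ^+ 2 <= C ^+ 2 * h ^+ 2 by rewrite -exprMn ler_sqr ?nnegrE; lra.
  move=> hv hle.
  have : v ^+ 2 * (1 + lambda * h) <= C ^+ 2 * h ^+ 2 * (1 + lambda * h).
    apply: ler_wpM2r => //; have := mulr_gt0 lambda_gt0 h0; lra.
  have h2 : 0 < h ^+ 2 by rewrite exprn_gt0.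
  move=> /(le_trans hle).
  have -> : 2 * lambda * (f (s + h) - f_inf) * h ^+ 2 =
    h ^+ 2 * (2 * lambda * (f (s + h) - f_inf)) by ring.
  have -> : C ^+ 2 * h ^+ 2 * (1 + lambda * h) =
    h ^+ 2 * (C ^+ 2 + C ^+ 2 * lambda * h) by ring.
  rewrite ler_pM2l// => hh.
  have : 2 * lambda * a < 2 * lambda * (f (s + h) - f_inf).
    by rewrite ltr_pM2l; [lra | rewrite mulr_gt0].
  rewrite /g in hg; lra.
have C0 : 0 < C by lra.
have KleC : K <= C by rewrite -ler_sqr ?nnegrE; lra.
have : K * C <= C * C by apply: ler_wpM2r; lra.
nra.
Qed.

(** Dini's criterion for [w a t + phi t]: the triangle inequality through [s] turns the local bound
    into the Dini condition. *)
Lemma dist_le_height a b : 0 < a -> a <= b ->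
  w a b <= energy_height a - energy_height b.
Proof.
move=> a0 ab.
suff: w a b + phi b <= w a a + phi a by rewrite w_xx// -/phi; lra.
apply: (@dini_nonincreasing _ (fun t => w a t + phi t)) => //.
  move=> c acb; apply: (left_lsc_of_dist w) => //; first lra.
  move=> r rc; have := w_tri a r c a0 ltac:(lra) ltac:(lra).
  have := energy_height_nonincreasing r c ltac:(lra) ltac:(lra).
  rewrite -/phi; lra.
move=> e e0 s sab.
have [t stb Ht] := local_dist_le_height s b e ltac:(lra) ltac:(lra) e0.
exists t => //; have := w_tri a s t a0 ltac:(lra) ltac:(lra).
by rewrite -/phi in Ht; lra.
Qed.

Lemma evi_flow_limit e : 0 < e ->
  exists2 T, 0 < T & forall t, T <= t -> D t <= e /\ energy_height t <= e.
Proof.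
move=> e0; have lam0 := lambda_gt0.
have le2 : 0 < lambda * e ^+ 2 by rewrite mulr_gt0// exprn_gt0.
(* Chosen so that [D 1 ^ 2 <= lambda * (t - 1) * e ^ 2] once [t >= 2 + k]. *)
pose k := D 1 ^+ 2 / (lambda * e ^+ 2).
have k0 : 0 <= k by rewrite divr_ge0 ?sqr_ge0// ltW.
exists (2 + k) => [|t kt]; first lra.
have t1 : 0 < lambda * (t - 1) by rewrite mulr_gt0//; lra.
have small v : 0 <= v -> lambda * (t - 1) * v ^+ 2 <= D 1 ^+ 2 -> v <= e.
  move=> v0 hv; rewrite -ler_sqr ?nnegrE//; last lra.
  rewrite -(ler_pM2l t1); apply: le_trans hv _.
  rewrite mulrAC -ler_pdivrMl// mulrC -/k; lra.
split; apply: small.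
- by apply: D_ge0; lra.
- by apply: minimizer_dist_decay; lra.
- exact: phi_ge0.
have -> : lambda * (t - 1) * energy_height t ^+ 2 =
    2 * (t - 1) * (lambda / 2 * phi t ^+ 2) by rewrite /phi; field.
by rewrite phi2; [apply: energy_decay|]; lra.
Qed.

End evi_flow.

(* [G] follows [c] with the level of [h] as a parameter: [G tau] is [c t] for
   the first time [t] with [h t <= h 0 * (1 - tau)]. *)
Lemma lipschitz_reparametrization {R : realType} {X : Type} (P : set X)
    (dr : X -> X -> R) (c : R -> X) (h : R -> R) (z : X) :
    (forall x, P x -> dr x x = 0) ->
    (forall x y, P x -> P y -> dr x y = dr y x) ->
    (forall x y w, P x -> P y -> P w -> dr x w <= dr x y + dr y w) ->
    (forall t, 0 <= t -> P (c t)) -> P z ->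
    (forall s t, 0 <= s -> s <= t -> dr (c s) (c t) <= h s - h t) ->
    left_continuous_flow (fun s t => dr (c s) (c t)) ->
    (forall t a, 0 <= t -> a < h t ->
       exists2 dl, 0 < dl & forall r, t < r < t + dl -> a < h r) ->
    (forall t, 0 <= t -> 0 <= h t) ->
    (forall t, 0 <= t -> dr (c t) z <= h t) ->
    (forall a, 0 < a -> exists2 t, 0 <= t & h t <= a) ->
  exists G : R -> X, [/\ G 0 = c 0, G 1 = z,
    forall tau, 0 <= tau <= 1 -> P (G tau) &
    forall s t, 0 <= s <= 1 -> 0 <= t <= 1 ->
      dr (G s) (G t) <= h 0 * `|s - t| ].
Proof.
move=> drxx drC drT Pc Pz ch c_left h_lsc h_ge0 hz h_to0.
pose S a := [set t | 0 <= t /\ h t <= a].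
pose T a := inf (S a).
have Slb a : has_lbound (S a) by exists 0 => t [].
have T_ge0 a : S a !=set0 -> 0 <= T a by move=> Sa; apply: lb_le_inf => // t [].
have hT a : S a !=set0 -> h (T a) <= a.
  move=> Sa; rewrite leNgt; apply/negP => haT.
  have [dl dl0 Hdl] := h_lsc _ _ (T_ge0 a Sa) haT.
  have [t [t0 ht] tT] := inf_adherent dl0 (conj Sa (Slb a)).
  have Tt : T a <= t by apply: ge_inf.
  have [Tt'|Tt'] := eqVneq (T a) t; first by move: haT; rewrite Tt'; lra.
  have := Hdl t; rewrite tT lt_neqAle Tt' Tt => /(_ isT); lra.
have gtT a r : 0 <= r -> r < T a -> a < h r.
  move=> r0 rT; rewrite ltNge; apply/negP => hr.
  have : T a <= r by apply: ge_inf.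
  lra.
have lip a b : a <= b -> S a !=set0 -> dr (c (T b)) (c (T a)) <= b - a.
  move=> ab Sa.
  have Sab : S a `<=` S b by move=> t [t0 ht]; split => //; exact: le_trans ab.
  have Sb : S b !=set0 by case: Sa => t /Sab; exists t.
  have Tb0 := T_ge0 b Sb; have Ta0 := T_ge0 a Sa.
  have Tba : T b <= T a.
    by apply: lb_le_inf => // t /Sab St; exact: ge_inf.
  have [->|TT] := eqVneq (T b) (T a); first by rewrite drxx ?subr_ge0//; exact: Pc.
  have {}TT : T b < T a by rewrite lt_neqAle TT.
  (* [h] may jump at [T a], so the estimate stops at some [r] just before it, where [h r > a] still
     holds; left continuity of [c] covers the rest. *)
  apply/ler_addgt0Pr => e e0.
  have [r0 /andP[r00 r0T] Hr0] := c_left (T a) e ltac:(lra) e0.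
  pose r := (Num.max r0 (T b) + T a) / 2.
  have m1 : r0 <= Num.max r0 (T b) by rewrite le_max lexx.
  have m2 : T b <= Num.max r0 (T b) by rewrite le_max lexx orbT.
  have m3 : Num.max r0 (T b) < T a by rewrite gt_max r0T.
  have r0r : r0 < r by rewrite /r; lra.
  have Tbr : T b <= r by rewrite /r; lra.
  have rTa : r < T a by rewrite /r; lra.
  have := Hr0 r; rewrite r0r rTa => /(_ isT) h1.
  have h2 := ch (T b) r Tb0 Tbr.
  have h3 := gtT a r ltac:(lra) rTa.
  have h4 := hT b Sb.
  have := drT _ _ _ (Pc _ Tb0) (Pc r ltac:(lra)) (Pc _ Ta0); lra.
have Sne tau : 0 <= tau -> tau < 1 -> S (h 0 * (1 - tau)) !=set0.
  move=> tau0 tau1; have [h00|h00] := eqVneq (h 0) 0.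
    by exists 0; rewrite /S/= h00 mul0r lexx.
  have [|t t0 ht] := h_to0 (h 0 * (1 - tau)); last by exists t.
  by rewrite mulr_gt0 ?subr_gt0// lt_neqAle eq_sym h00 h_ge0.
(* Level [0] may never be reached, so the endpoint is set to [z] by hand. *)
pose G tau := if tau < 1 then c (T (h 0 * (1 - tau))) else z.
have PG tau : 0 <= tau <= 1 -> P (G tau).
  move=> /andP[tau0 _]; rewrite /G; case: ifPn => // tau1.
  by apply/Pc/T_ge0/Sne.
have Glip s t : 0 <= s -> s <= t -> t <= 1 -> dr (G s) (G t) <= h 0 * (t - s).
  move=> s0 st t1; rewrite /G.
  have h00 := h_ge0 0 (lexx _).
  have [tlt|tge] := ltP t 1.
    have slt : s < 1 by lra.
    rewrite slt; apply: le_trans (lip (h 0 * (1 - t)) (h 0 * (1 - s)) _ _) _.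
    - by apply: ler_wpM2l => //; lra.
    - by apply: Sne => //; lra.
    - by rewrite le_eqVlt; apply/orP; left; apply/eqP; ring.
  have te1 : t = 1 by lra.
  have [slt|sge] := ltP s 1; last first.
    have -> : s = 1 by lra.
    by rewrite drxx// te1 subrr mulr0.
  have Ss := Sne s s0 slt.
  by rewrite te1; apply: le_trans (hz _ (T_ge0 _ Ss)) (hT _ Ss).
exists G; split => //.
- rewrite /G ltr01 subr0 mulr1; congr c.
  apply/eqP; rewrite eq_le; apply/andP; split.
    by apply: ge_inf => //; rewrite /S/= !lexx.
  by apply: T_ge0; exists 0; rewrite /S/= !lexx.
- by rewrite /G ltxx.
move=> s t s01 t01; have [st|ts] := leP s t.
  by rewrite distrC ger0_norm ?subr_ge0//; apply: Glip; lra.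
rewrite drC; [|exact: PG..].
by rewrite gtr0_norm ?subr_gt0//; apply: Glip; lra.
Qed.

(** * Lengths of curves and absolute continuity *)

Local Open Scope ereal_scope.

(* [ge0_le_integral] asks for measurability, which a metric derivative need not
   have. *)
Lemma ge0_le_integral_pointwise {dsp : measure_display}
    {T : measurableType dsp} {R : realType} (mu : {measure set T -> \bar R})
    (A : set T) (f h : T -> \bar R) :
    (forall x, A x -> 0 <= f x) -> (forall x, A x -> f x <= h x) ->
  \int[mu]_(x in A) f x <= \int[mu]_(x in A) h x.
Proof.
move=> f0 fh.
have h0 x : A x -> 0 <= h x by move=> Ax; exact: le_trans (f0 x Ax) (fh x Ax).
rewrite !ge0_integralE//; apply: ge_ereal_sup => _ [k kf <-].
apply: ereal_sup_ubound; exists k => // x; apply: le_trans (kf x) _.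
exact: lee_restrict.
Qed.

Lemma limf_esup_ubound {T : choiceType} {X : filteredType T} {R : realType}
    (f : X -> \bar R) (F : set (set X)) (b e : R) :
    (0 < e)%R -> limf_esup f F <= b%:E ->
  exists2 V, F V & forall x, V x -> f x <= (b + e)%:E.
Proof.
move=> e0 fb.
have : limf_esup f F < (b + e)%:E.
  by apply: le_lt_trans fb _; rewrite lte_fin ltrDl.
move=> /ereal_inf_lt[_ [V FV <-] Ve]; exists V => // x Vx.
by apply: le_trans (ltW Ve); apply: ereal_sup_ubound; exists x.
Qed.

Section curves.
Context {R : realType} {X : Type} (d : X -> X -> \bar R).
Hypothesis d_metric : extended_metric d.

Local Notation I01 := (`[0%R, 1%R]%classic : set R).

Lemma AC_curve_dist_lty (g : R -> X) : AC_curve d 1 I01 g -> d (g 0%R) (g 1%R) < +oo.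
Proof.
move=> [m /Lfun1_integrable mI dm].
have I0 : I01 0%R by rewrite /= in_itv /= lexx ler01.
have I1 : I01 1%R by rewrite /= in_itv /= lexx ler01.
apply: le_lt_trans (dm 0%R 1%R I0 I1 ltr01) _.
apply: integrable_lty => //; apply/integrable_mkcond => //.
by move: mI; rewrite -restrict_EFin.
Qed.

(** A finite infimum provides an admissible curve; this makes [d] real-valued on [Y]. *)
Lemma length_dist_lty (Y : set X) (y y' : X) :
  length_dist d Y y y' < +oo -> d y y' < +oo.
Proof.
move=> /ereal_inf_lt[_ [g [gAC _ <- <-] _] _].
exact: AC_curve_dist_lty.
Qed.

(** A supremum over an empty set would be [-oo], so every ball around [t] must be shown to meet the
    interval in a point other than [t]. *)
Lemma metric_derivative_ge0 (g : R -> X) (t : R) : I01 t ->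
  0 <= metric_derivative d I01 g t.
Proof.
move=> tI; apply: limf_esup_ge0 => [|s]; last first.
  by rewrite mule_ge0 ?inve_ge0 ?lee_fin// emetric_ge0.
move: tI; rewrite /= in_itv/= => t01.
rewrite /dnbhs /within /= => /nbhs_ballP[e /= e0 He].
have [s [st s01 se]] : exists s, [/\ s != t, (0 <= s <= 1)%R & (`|t - s| < e)%R].
  have [t1|t1] := ltP t 1%R.
    pose h := Num.min (e / 2)%R (1 - t)%R.
    have h0 : (0 < h)%R by rewrite lt_min; apply/andP; split; lra.
    have he : (h <= e / 2)%R by rewrite ge_min lexx.
    have ht : (h <= 1 - t)%R by rewrite ge_min lexx orbT.
    exists (t + h)%R; split; first by rewrite gt_eqF// ltrDl.
      by lra.
    by rewrite opprD addrA subrr add0r normrN gtr0_norm//; lra.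
  pose h := Num.min (e / 2)%R 1%R.
  have h0 : (0 < h)%R by rewrite lt_min; apply/andP; split; lra.
  have he : (h <= e / 2)%R by rewrite ge_min lexx.
  have ht : (h <= 1)%R by rewrite ge_min lexx orbT.
  exists (t - h)%R; split; first by rewrite lt_eqF// ltrBlDr ltrDl.
    by lra.
  by rewrite opprB addrCA subrr addr0 gtr0_norm//; lra.
by apply: (He s se st); rewrite in_itv.
Qed.

Lemma length_dist_ge0 (Y : set X) (y y' : X) : 0 <= length_dist d Y y y'.
Proof.
apply: le_ereal_inf_tmp => _ [g _ <-]; apply: integral_ge0 => t tI.
exact: metric_derivative_ge0.
Qed.

Lemma metric_derivative_le_lipschitz (g : R -> X) (L t : R) :
    (forall s t, I01 s -> I01 t -> d (g s) (g t) <= (L * `|s - t|)%:E) ->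
    I01 t -> metric_derivative d I01 g t <= L%:E.
Proof.
move=> gL tI; apply: ge_ereal_inf.
exists (ereal_sup [set d (g s) (g t) / `|s - t|%:E | s in [set s | s != t /\ I01 s]]).
  exists [set s | s != t /\ I01 s] => //.
  rewrite /within /=; near=> s => sI; split => //.
  by near: s; exact: nbhs_dnbhs_neq.
apply: ge_ereal_sup => _ [s [st sI] <-].
have st0 : (0 < `|s - t|)%R by rewrite normr_gt0 subr_eq0.
rewrite inver gt_eqF// lee_pdivrMr//; exact: gL.
Unshelve. all: by end_near. Qed.

(** The constant [L] is both the integrable modulus that makes [g] admissible and a bound on its
    metric derivative. *)
Lemma length_dist_le_lipschitz (Y : set X) (g : R -> X) (L : R) :
    (forall t, I01 t -> Y (g t)) ->
    (forall s t, I01 s -> I01 t -> d (g s) (g t) <= (L * `|s - t|)%:E) ->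
  length_dist d Y (g 0%R) (g 1%R) <= L%:E.
Proof.
move=> gY gL; apply: ge_ereal_inf; exists (curve_length d g).
  exists g => //; split => //.
  exists (cst L) => [|s t sI tI st].
    apply/Lfun1_integrable; rewrite -restrict_EFin.
    suff: lebesgue_measure.-integrable I01 (cst L%:E).
      move=> h; apply: (iffLR (integrable_mkcond (cst L%:E) _) h).
      exact: measurable_itv.
    apply/integrableP; split; first exact: measurable_cst.
    rewrite /= (eq_integral (cst `|L|%:E))// integral_cst//=.
    by rewrite lebesgue_measure_itv/= lte_fin ltr01 sube0 mule1 ltry.
  apply: le_trans (gL s t sI tI) _.
  rewrite (eq_integral (cst L%:E))// integral_cst//=.
  rewrite lebesgue_measure_itv/= lte_fin st.
  by rewrite -EFinB -EFinM distrC gtr0_norm// subr_gt0.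
apply: (@le_trans _ _ (\int[lebesgue_measure]_(t in I01) L%:E)).
  apply: ge0_le_integral_pointwise => t tI; first exact: metric_derivative_ge0.
  exact: metric_derivative_le_lipschitz.
rewrite (eq_integral (cst L%:E))// integral_cst//=.
by rewrite lebesgue_measure_itv/= lte_fin ltr01 sube0 mule1.
Qed.

(** Young's inequality [|m| <= k + m ^ 2 / k] with [k] free, integrated over [[s, t]]; [C] is the
    integral of [m ^ 2]. *)
Lemma AC2_dist_bound (g : R -> X) (a b : R) : AC_curve d 2%:E `[a, b] g ->
  exists2 C : R, (0 <= C)%R & forall s t k, (a <= s)%R -> (s < t)%R -> (t <= b)%R ->
    (0 < k)%R -> d (g s) (g t) <= (k * (t - s) + C / k)%:E.
Proof.
move=> [m mI dm]; set M := (m \_ `[a, b])%R in mI.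
have M2 := Lfun2_integrable_sqr mI.
have mM : measurable_fun setT M by move: mI; rewrite inE => /andP[/[!inE]].
set C := \int[lebesgue_measure]_x (M x ^+ 2)%:E.
have C0 : 0 <= C by apply: integral_ge0 => x _; rewrite lee_fin sqr_ge0.
have Cfin : C \is a fin_num by exact: integrable_fin_num.
exists (fine C) => [|s t k sa st tb k0]; first exact: fine_ge0.
have sI : `[a, b]%classic s by rewrite /= in_itv/=; lra.
have tI : `[a, b]%classic t by rewrite /= in_itv/=; lra.
apply: le_trans (dm s t sI tI st) _.
have -> : \int[lebesgue_measure]_(u in `[s, t]) (m u)%:E =
          \int[lebesgue_measure]_(u in `[s, t]) (M u)%:E.
  apply: eq_integral => u; rewrite inE/= in_itv/= => ust.
  by rewrite /M patchE mem_set//= in_itv/=; lra.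
apply: le_trans (lee_abs _) _.
have mMst : measurable_fun `[s, t] M by exact: measurable_funTS.
apply: le_trans (le_abse_integral _ _ _) _ => //.
  exact/measurable_EFinP.
apply: (@le_trans _ _ (\int[lebesgue_measure]_(u in `[s, t])
    (k%:E + k^-1%:E * (M u ^+ 2)%:E))).
  apply: ge0_le_integral_pointwise => // u _; rewrite lee_fin.
  have : (0 <= (k - `|M u|) ^+ 2 + `|M u| * k)%R.
    by rewrite addr_ge0 ?sqr_ge0// mulr_ge0// ltW.
  rewrite -(ler_pM2l k0) mulrDr mulrA divff ?gt_eqF// mul1r.
  rewrite -[(M u ^+ 2)%R]real_normK ?num_real//.
  by move: `|M u|%R => v; nra.
have mM2 : measurable_fun `[s, t] (fun u => (M u ^+ 2)%:E).
  by apply/measurable_EFinP; exact: measurable_funX.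
rewrite ge0_integralD//; last 3 first.
- by move=> u _; rewrite lee_fin ltW.
- by move=> u _; rewrite -EFinM lee_fin mulr_ge0 ?sqr_ge0 ?invr_ge0 ?ltW.
- exact: emeasurable_funM.
rewrite (eq_integral (cst k%:E))// integral_cst//= lebesgue_measure_itv/= lte_fin st.
rewrite -EFinB -EFinM EFinD.
rewrite leeD2l// ge0_integralZl_EFin//; last 2 first.
- by move=> u _; rewrite lee_fin sqr_ge0.
- by rewrite invr_ge0 ltW.
rewrite mulrC EFinM fineK// lee_pmul2l ?lte_fin ?invr_gt0//.
apply: ge0_subset_integral => //; last by move=> x _; rewrite lee_fin sqr_ge0.
by apply/measurable_EFinP; exact: measurable_funX.
Qed.

Lemma AC2loc_segment (g : R -> X) (a b : R) : AC2loc d g -> (0 < a)%R ->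
  AC_curve d 2%:E `[a, b] g.
Proof.
move=> gAC a0; apply: gAC => [||x/=]; first exact: interval_is_interval.
  exact/compact_bounded/segment_compact.
by rewrite !in_itv/= andbT => /andP[ax _]; exact: lt_le_trans ax.
Qed.

Lemma AC2loc_left_continuous (g : R -> X) (t e : R) : AC2loc d g ->
    (0 < t)%R -> (0 < e)%R ->
  exists2 r0 : R, (0 <= r0 < t)%R &
    forall r, (r0 < r < t)%R -> d (g r) (g t) <= e%:E.
Proof.
move=> gAC t0 e0.
have [|C C0 HC] := AC2_dist_bound g (t / 2)%R t (AC2loc_segment g _ t gAC _).
  by lra.
(* This makes [C / k <= e / 2]; times within [e / 2 / k] of [t] then keep the other term below
   [e / 2]. *)
pose k : R := (2 * (C + 1) / e)%R.
have k0 : (0 < k)%R by rewrite divr_gt0//; lra.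
have ek : (0 < e / 2 / k)%R by rewrite divr_gt0//; lra.
exists (Num.max (t / 2)%R (t - e / 2 / k)%R).
  by rewrite le_max gt_max; apply/andP; split; [apply/orP; left|apply/andP; split]; lra.
move=> r; rewrite gt_max => /andP[/andP[r1 r2] rt].
apply: le_trans (HC r t k _ _ _ _) _ => //; first lra.
rewrite lee_fin.
have : (k * (t - r) <= e / 2)%R by rewrite mulrC -ler_pdivlMr//; lra.
have : (C / k <= e / 2)%R.
  rewrite ler_pdivrMr// /k.
  have -> : (e / 2 * (2 * (C + 1) / e) = C + 1)%R by field; lra.
  lra.
lra.
Qed.

End curves.

(** * Real inequalities extracted from an EVI flow *)

Section evi.
Context {R : realType} {X : Type} (d : X -> X -> \bar R) (E : X -> \bar R).
Variables (lambda : R) (g : R -> X).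
Hypothesis d_metric : extended_metric d.
Hypothesis g_evi : EVI_flow d E lambda g.

Let g_AC : AC2loc d g. Proof. by case: g_evi. Qed.

Lemma EVI_flow_energy_fin (t : R) : (0 < t)%R -> E (g t) \is a fin_num.
Proof. by case: g_evi => _ _ + _; exact. Qed.

Lemma EVI_flow_energy_lsc (t a : R) : (0 < t)%R -> (a < fine (E (g t)))%R ->
  exists2 dl, (0 < dl)%R & forall r, (0 < r)%R -> (`|r - t| < dl)%R ->
    (a < fine (E (g r)))%R.
Proof.
move=> t0; case: g_evi => _ lsc _ _.
rewrite -lte_fin fineK ?EVI_flow_energy_fin// => /lsc[V].
rewrite -nbhs_subspace_interior; last first.
  apply: open_nbhs_nbhs; split; first exact: interval_open.
  by rewrite /= in_itv/= t0.
move=> /nbhs_ballP[dl /= dl0 Hdl] HV; exists dl => // r r0 rt.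
rewrite -lte_fin fineK ?EVI_flow_energy_fin//; apply: HV; apply: Hdl.
by rewrite /ball/= distrC.
Qed.

Lemma EVI_flow_evi_along (x : X) : E x \is a fin_num ->
    (forall t, (0 < t)%R -> d (g t) x \is a fin_num) ->
  evi_along lambda (fun t => fine (d (g t) x) ^+ 2)%R (fun t => fine (E (g t)))
    (fine (E x)).
Proof.
move=> Ex dfin t e tpos e0.
have ED : effective_domain E x by rewrite /effective_domain/= -(fineK Ex) ltry.
have dset : dist_to_set d x [set g t | t in `]0%R, +oo[] < +oo.
  apply: (@le_lt_trans _ _ (d x (g t))).
    apply: ereal_inf_lbound; exists (g t) => //.
    by exists t => //=; rewrite in_itv/= tpos.
  by rewrite (emetric_sym d_metric) -(fineK (dfin t tpos)) ltry.
case: g_evi => _ _ _ /(_ x ED dset t tpos).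
have Et := EVI_flow_energy_fin t tpos.
rewrite -(fineK (dfin t tpos)) -(fineK Ex) -(fineK Et).
set dt := fine (d (g t) x); set ex := fine (E x); set et := fine (E (g t)).
set U := upper_right_derivative _ _ => H.
have {}H : U <= (2 * (ex - et) - lambda * dt ^+ 2)%:E.
  (* The value [+oo] of [U] contradicts the finite right-hand side, and [-oo] is harmless. *)
  move: H; rewrite -EFin_expe -EFinM -EFinB; case: U => [u| |].
  - rewrite -!EFinM -!EFinD !lee_fin; lra.
  - rewrite mulry gtr0_sg ?invr_gt0// mul1e.
    by rewrite addye// leye_eq.
  - by move=> _; rewrite leNye.
have [V] := limf_esup_ubound _ _ _ _ e0 H.
rewrite /at_right /within /= => /nbhs_ballP[dl /= dl0 Hdl] HV.
exists dl => // s /andP[ts tdl].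
have : V s by apply: Hdl => //; rewrite /ball/= distrC gtr0_norm//; lra.
move=> /HV; cbv beta; have st : (0 < s - t)%R by lra.
rewrite -(fineK (dfin s ltac:(lra))) -(fineK (dfin t tpos)) inver gt_eqF//.
by rewrite -!EFinM lee_fin -!expr2/= ler_pdivrMr// [leRHS]mulrC.
Qed.

End evi.

(** * The flow extended to time zero, and the resulting curve to the minimiser *)

Theorem proposition2p2 (R : realType) (lambda : R) (lambda_gt0 : (0 < lambda)%R)
  (X : Type) (d : X -> X -> \bar R) (d_metric : extended_metric d)
  (E : X -> \bar R) (E_gtNy : forall x, -oo < E x)
  (E_bounded_below : exists c : R, forall x, c%:E <= E x)
  (E_proper : effective_domain E !=set0)
  (Y : set X)
  (flow : forall y, Y y -> effective_domain E y ->
     exists g : R -> X, [/\ EVI_flow d E lambda g, starts_from d E g y &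
                            forall t : R, (0 < t)%R -> Y (g t)])
  (Y_geodesic : geodesic_space d Y)
  (ystar : X) (Y_ystar : Y ystar) (ystar_min : E ystar = ereal_inf (E @` Y)) :
  (* for [E y = +oo] the inequality is true by convention, also when
     [E ystar = +oo] *)
  forall y, Y y -> effective_domain E y ->
    length_dist d Y y ystar ^+ 2 <= (2 / lambda)%:E * (E y - E ystar).
Proof.
move=> y Yy Ey.
have [g [g_evi [g_start g_liminf] Yg]] := flow y Yy Ey.
have Emin x : Y x -> E ystar <= E x.
  by move=> Yx; rewrite ystar_min; apply: ereal_inf_lbound; exists x.
have Eyfin : E y \is a fin_num by rewrite fin_numElt E_gtNy.
have Esfin : E ystar \is a fin_num.
  by rewrite fin_numElt E_gtNy (le_lt_trans (Emin y Yy)).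
have Egfin t : (0 < t)%R -> E (g t) \is a fin_num.
  exact: (EVI_flow_energy_fin d E lambda g g_evi).
(* Geodesics have finite length distance, which dominates finiteness of [d] on [Y]. *)
have dfin a b : Y a -> Y b -> d a b \is a fin_num.
  move=> Ya Yb; rewrite ge0_fin_numE; last exact: (emetric_ge0 d_metric).
  have [c [_ _ _ /(_ 0%R 0%R)]] := Y_geodesic a b Ya Yb.
  by rewrite lexx ler01 => /(_ isT isT)[_]; exact: length_dist_lty.
pose dr a b := fine (d a b).
have drE a b : Y a -> Y b -> d a b = (dr a b)%:E.
  by move=> Ya Yb; rewrite fineK// dfin.
have dr_ge0 a b : (0 <= dr a b)%R by apply: fine_ge0; exact: (emetric_ge0 d_metric).
have drxx a : dr a a = 0%R by rewrite /dr ((emetric_eq0 d_metric _ _).2 erefl).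
have drC a b : dr a b = dr b a by rewrite /dr (emetric_sym d_metric).
have drT a b c : Y a -> Y b -> Y c -> (dr a c <= dr a b + dr b c)%R.
  move=> Ya Yb Yc; rewrite -lee_fin EFinD -!drE//.
  exact: (emetric_triangle d_metric).
have dr0 a b : Y a -> Y b -> dr a b = 0%R -> a = b.
  by move=> Ya Yb h; apply/(emetric_eq0 d_metric); rewrite drE// h.
pose f t := fine (E (g t)).
pose f_inf := fine (E ystar).
have g_AC : AC2loc d g by case: g_evi.
have w_left : left_continuous_flow (fun s t => dr (g s) (g t)).
  move=> t e t0 e0.
  have [r0 r0t Hr0] := AC2loc_left_continuous d g t e g_AC t0 e0.
  exists r0 => // r rt; have := Hr0 r rt.
  by rewrite drE ?lee_fin//; apply: Yg => //; lra.
have f_ge t : (0 < t)%R -> (f_inf <= f t)%R.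
  by move=> t0; apply: fine_le => //; [exact: Egfin | apply/Emin/Yg].
have evi_at x : Y x -> E x \is a fin_num ->
    evi_along lambda (fun t => dr (g t) x ^+ 2)%R f (fine (E x)).
  move=> Yx Ex; apply: (EVI_flow_evi_along d E lambda g d_metric g_evi) => // t t0.
  by apply: dfin => //; exact: Yg.
have evi_w s : (0 < s)%R -> evi_along lambda (fun t => dr (g s) (g t) ^+ 2)%R f (f s).
  move=> s0; have := evi_at (g s) (Yg s s0) (Egfin s s0).
  by congr evi_along; apply: funext => t; rewrite drC.
have w_tri r s t : (0 < r)%R -> (0 < s)%R -> (0 < t)%R ->
    (dr (g r) (g t) <= dr (g r) (g s) + dr (g s) (g t))%R.
  by move=> r0 s0 t0; apply: drT; exact: Yg.
have f_const s t : (0 < s)%R -> (0 < t)%R -> dr (g s) (g t) = 0%R -> f s = f t.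
  by move=> s0 t0 /(dr0 _ _ (Yg s s0) (Yg t t0)); rewrite /f => ->.
have f_lsc t a := EVI_flow_energy_lsc d E lambda g g_evi t a.
have f_mono a b : (0 < a)%R -> (a <= b)%R -> (f b <= f a)%R.
  apply: (energy_nonincreasing lambda (fun s t => dr (g s) (g t)) f f_inf) => //.
have D_tri s t : (0 < s)%R -> (0 < t)%R ->
    (dr (g s) ystar <= dr (g t) ystar + dr (g s) (g t))%R.
  by move=> s0 t0; rewrite addrC; apply: drT => //; exact: Yg.
have D_tri' s t : (0 < s)%R -> (0 < t)%R ->
    (dr (g t) ystar <= dr (g s) ystar + dr (g s) (g t))%R.
  by move=> s0 t0; rewrite addrC (drC (g s) (g t)); apply: drT => //; exact: Yg.
have evi_D := evi_at ystar Y_ystar Esfin.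
pose phi := energy_height lambda f f_inf.
have phi_dist a b : (0 < a)%R -> (a <= b)%R ->
    (dr (g a) (g b) <= phi a - phi b)%R.
  by apply: (dist_le_height lambda (fun s t => dr (g s) (g t)) f
    (fun t => dr (g t) ystar) f_inf).
have phi_lim e : (0 < e)%R -> exists2 T, (0 < T)%R &
    forall t, (T <= t)%R -> (dr (g t) ystar <= e)%R /\ (phi t <= e)%R.
  by apply: (evi_flow_limit lambda (fun s t => dr (g s) (g t)) f
    (fun t => dr (g t) ystar) f_inf).
have start_dist e : (0 < e)%R -> exists2 dl, (0 < dl)%R &
    forall t, (0 < t < dl)%R -> (dr (g t) y <= e)%R.
  move=> e0; move: g_start => /fine_cvgP[_ /cvgrPdist_le/(_ e e0)].
  rewrite near_withinE => /nbhs_ballP[dl /= dl0 Hdl]; exists dl => // t /andP[t0 tdl].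
  have := Hdl t; rewrite /ball/= sub0r normrN gtr0_norm// => /(_ tdl t0).
  by apply: le_trans; rewrite sub0r normrN; exact: ler_norm.
(* If [f t > E y], monotonicity keeps the energy above [E y] on [(0, t]], so the EVI with base point
   [y] makes the distance to [y] nonincreasing there. It tends to zero at time zero, hence
   [g t = y], a contradiction. *)
have f_start t : (0 < t)%R -> (f t <= fine (E y))%R.
  move=> t0; rewrite leNgt; apply/negP => ft.
  suff ty : dr (g t) y = 0%R.
    by move: ft; rewrite /f (dr0 _ _ (Yg t t0) Yy ty) ltxx.
  have dec a : (0 < a)%R -> (a <= t)%R -> (dr (g t) y ^+ 2 <= dr (g a) y ^+ 2)%R.
    move=> a0 at_.
    have := @evi_along_quadratic_bound _ lambda (fine (E y)) 0 0 a t _ _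
      (evi_at y Yy Eyfin) a0 at_ (lexx _).
    rewrite !mul0r !addr0; apply => [c ac|s st].
      apply: (left_lsc_sqr (fun s t => dr (g s) (g t))) => //; first lra.
      move=> r rc; rewrite addrC (drC (g r) (g c)); apply: drT => //; apply: Yg; lra.
    have := f_mono s t ltac:(lra) ltac:(lra).
    have : (0 <= lambda * dr (g s) y ^+ 2)%R by rewrite mulr_ge0 ?sqr_ge0// ltW.
    lra.
  apply/eqP; rewrite eq_le dr_ge0 andbT; apply/ler_addgt0Pr => e e0.
  have [dl dl0 Hdl] := start_dist e e0.
  pose a := Num.min t (dl / 2)%R.
  have a0 : (0 < a)%R by rewrite lt_min t0; lra.
  have at_ : (a <= t)%R by rewrite ge_min lexx.
  have adl : (a <= dl / 2)%R by rewrite ge_min lexx orbT.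
  rewrite add0r; apply: le_trans (Hdl a ltac:(lra)).
  by have := dec a a0 at_; rewrite ler_sqr ?nnegrE.
have f_start_lsc e : (0 < e)%R -> exists2 dl, (0 < dl)%R &
    forall t, (0 < t < dl)%R -> (fine (E y) - e <= f t)%R.
  move=> e0.
  have : limf_esup (fun t => - E (g t)) (0 : R)^'+ <= (- fine (E y))%:E.
    by rewrite EFinN fineK// leeNr.
  move=> /(limf_esup_ubound _ _ _ _ e0)[V].
  rewrite /at_right /within/= => /nbhs_ballP[dl /= dl0 Hdl] HV.
  exists dl => // t /andP[t0 tdl].
  have : V t by apply: Hdl => //; rewrite /ball/= sub0r normrN gtr0_norm.
  by move=> /HV; rewrite -(fineK (Egfin t t0)) -EFinN lee_fin -/(f t); lra.
(* [L] is the claimed bound; [c] and [h] extend the flow and its height to time zero by [y] and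
   [L]. *)
pose L := Num.sqrt (2 / lambda * (fine (E y) - f_inf)).
pose c t := if (0 < t)%R then g t else y.
pose h t := if (0 < t)%R then phi t else L.
have lam2 : (0 < 2 / lambda)%R by rewrite divr_gt0.
have phiL t : (0 < t)%R -> (phi t <= L)%R.
  move=> t0; apply: ler_wsqrtr; apply: ler_wpM2l; first exact: ltW.
  by have := f_start t t0; lra.
have Pc t : (0 <= t)%R -> Y (c t) by rewrite /c; case: ifPn => // t0 _; exact: Yg.
have c_pos t : (0 < t)%R -> c t = g t by rewrite /c => ->.
have h_pos t : (0 < t)%R -> h t = phi t by rewrite /h => ->.
have c0 : c 0%R = y by rewrite /c ltxx.
have h0 : h 0%R = L by rewrite /h ltxx.
have ch s t : (0 <= s)%R -> (s <= t)%R -> (dr (c s) (c t) <= h s - h t)%R.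
  move=> s0 st; have [s_eq0|s_neq0] := eqVneq s 0%R; last first.
    by rewrite !c_pos ?h_pos//; [apply: phi_dist | ..]; lra.
  rewrite s_eq0 c0 h0.
  have [->|t_neq0] := eqVneq t 0%R; first by rewrite c0 h0 drxx subrr.
  have t0 : (0 < t)%R by lra.
  rewrite c_pos// h_pos//; apply/ler_addgt0Pr => e e0.
  (* Pass through [g r] with [r] so small that its distance to [y] is at most [e], and use
     [phi r <= L]. *)
  have [dl dl0 Hdl] := start_dist e e0.
  pose r := Num.min t (dl / 2)%R.
  have r0 : (0 < r)%R by rewrite lt_min t0; lra.
  have rt : (r <= t)%R by rewrite ge_min lexx.
  have rdl : (r <= dl / 2)%R by rewrite ge_min lexx orbT.
  have := Hdl r ltac:(lra); rewrite drC.
  have := drT y (g r) (g t) Yy (Yg r r0) (Yg t t0).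
  have := phi_dist r t r0 rt; have := phiL r r0; lra.
have c_left : left_continuous_flow (fun s t => dr (c s) (c t)).
  move=> t e t0 e0; have [r0 r0t Hr0] := w_left t e t0 e0.
  by exists r0 => // r rt; rewrite !c_pos; [apply: Hr0 | lra..].
have h_lsc t a : (0 <= t)%R -> (a < h t)%R -> exists2 dl, (0 < dl)%R &
    forall r, (t < r < t + dl)%R -> (a < h r)%R.
  move=> t0 aht.
  have [a0|a0] := ltP a 0%R.
    exists 1%R => // r _; apply: lt_le_trans a0 _.
    by rewrite /h; case: ifP => _; exact: sqrtr_ge0.
  (* [m] is the energy at height [a], so semicontinuity of [h] reduces to that of [f], and at time
     zero to the liminf condition on the start. *)
  pose m := (lambda / 2 * a ^+ 2 + f_inf)%R.
  have lvl u : (a < Num.sqrt (2 / lambda * (u - f_inf)))%R = (m < u)%R.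
    have -> : (m < u)%R = (a ^+ 2 < 2 / lambda * (u - f_inf))%R.
      have l2 : (0 < lambda / 2)%R by rewrite divr_gt0.
      rewrite -[RHS](ltr_pM2l l2) /m -ltrBrDr; congr (_ < _)%R; field; lra.
    rewrite -[X in (X < Num.sqrt _)%R](ger0_norm a0) -sqrtr_sqr.
    apply/idP/idP => [|q]; last by rewrite ltr_sqrt// (le_lt_trans (sqr_ge0 a)).
    by rewrite !ltNge; apply: contra => q; exact: ler_wsqrtr.
  suff [dl dl0 Hdl] : exists2 dl, (0 < dl)%R &
      forall r, (t < r < t + dl)%R -> (m < f r)%R.
    exists dl => // r rt; have r0 : (0 < r)%R by lra.
    by rewrite h_pos// /phi /energy_height lvl; exact: Hdl.
  have [tpos|tneg] := ltP 0%R t.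
    move: aht; rewrite h_pos// /phi /energy_height lvl => /(f_lsc t m tpos)[dl dl0 Hdl].
    exists dl => // r rt; apply: Hdl; first lra.
    by rewrite gtr0_norm; lra.
  have t_eq0 : t = 0%R by lra.
  move: aht; rewrite t_eq0 h0 lvl => mE.
  have [|dl dl0 Hdl] := f_start_lsc ((fine (E y) - m) / 2)%R; first lra.
  exists dl => // r rt; have := Hdl r ltac:(lra); lra.
have h_ge0 t : (0 <= t)%R -> (0 <= h t)%R.
  by move=> _; rewrite /h; case: ifP => _; exact: sqrtr_ge0.
have h_to0 a : (0 < a)%R -> exists2 t, (0 <= t)%R & (h t <= a)%R.
  move=> a0; have [T T0 HT] := phi_lim a a0.
  by exists T; [exact: ltW | rewrite h_pos//; case: (HT T (lexx _))].
have hz t : (0 <= t)%R -> (dr (c t) ystar <= h t)%R.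
  move=> t0; apply/ler_addgt0Pr => e e0; have [T T0 HT] := phi_lim e e0.
  (* At the late time [r] the flow is within [e] of [ystar], and reaching it from [c t] costs at
     most [h t]. *)
  pose r := Num.max t T.
  have tr : (t <= r)%R by rewrite le_max lexx.
  have Tr : (T <= r)%R by rewrite le_max lexx orbT.
  have [Dr _] := HT r Tr; have r0 : (0 < r)%R by lra.
  have := ch t r t0 tr; have := h_ge0 r (ltW r0); rewrite (c_pos r r0).
  have := drT (c t) (g r) ystar (Pc t t0) (Yg r r0) Y_ystar; lra.
have [G [G0 G1 YG Glip]] := lipschitz_reparametrization Y dr c h ystar
  (fun x _ => drxx x) (fun a b _ _ => drC a b) drT Pc Y_ystar ch c_left h_lsc
  h_ge0 hz h_to0.
have len : length_dist d Y y ystar <= L%:E.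
  rewrite -c0 -G0 -G1; apply: length_dist_le_lipschitz => //.
  move=> s t; rewrite /= !in_itv/= => s01 t01.
  by rewrite (drE _ _ (YG s s01) (YG t t01)) lee_fin -h0; exact: Glip.
have len0 : 0 <= length_dist d Y y ystar by exact: length_dist_ge0.
apply: (@le_trans _ _ (L%:E ^+ 2)); first by rewrite !expe2; exact: lee_pmul.
rewrite -EFin_expe sqr_sqrtr.
  by rewrite EFinM EFinB /f_inf !fineK.
apply: mulr_ge0; first exact: ltW.
by rewrite subr_ge0; apply: fine_le => //; exact: Emin.
Qed.
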